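(* For all integers $d \geq k > 0$ there is a constant $c > 0$, depending only on $d$ and $k$, such that the following holds. Let $F$ be a finite field, let $n$ be a positive integer, let $0 \leq \beta \leq 1$, and let $\mathbf{L}$ be a collection (set) of $k$-planes in $F^n$ with $$|\mathbf{L}| \geq |F|^{(k+1)(d-k)+\beta}.$$ Then $$\Big|\bigcup_{L \in \mathbf{L}} L\Big| \geq c\,|F|^{d+\beta}.$$
   Context: $|\cdot|$ denotes cardinality. A $k$-plane in $F^n$ is a translate of a $k$-dimensional linear subspace of $F^n$, regarded as a set of points. *)

(* Defs.v *)
From mathcomp Require Import all_boot all_order all_algebra.

Set Implicit Arguments.
Unset Strict Implicit.
Unset Printing Implicit Defensive.

Definition kplane (F : finFieldType) (n k : nat) (P : {set 'rV[F]_n}) : Prop :=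
  exists (v : 'rV[F]_n) (W : {vspace 'rV[F]_n}),
    \dim W = k /\ P = [set (v + w)%R | w in W].

(* Main.v *)
Require Import Defs.
From HB Require Import structures.
From mathcomp Require Import all_boot all_order all_algebra finfield.
From mathcomp Require Import reals exp.
From mathcomp Require Import zify ring.

(** Write [q] for the size of the field; all bounds below are up to constants.
    Placed at height 1 in [F^(1+n)], a [k]-plane of [F^n] spans a linear
    subspace of dimension [m = k + 1], and a union [Y] of [k]-planes spans a
    cone with [(q - 1) |Y|] nonzero vectors. With [D = d + 1] the theorem
    follows from a statement about linear subspaces ([union_bound m D], proved
    for all [1 <= m <= D] in [linear_union_bound]): if [L] is a family of
    [m]-dimensional subspaces, each having a positive proportion of its vectors
    in a cone [P], then [|P|] is at least [q^D min(|L| / q^(m(D-m)), q)]. This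
    form is linear in [|L|] until it saturates at [q^(D+1)], which makes it
    usable for families of uncontrolled size inside the induction; requiring
    only a proportion of each subspace to lie in [P] lets the points be thinned
    out freely. For a field of bounded size the bound is trivial.

    For [m = 1] the members of [L] are disjoint apart from 0. For [m = D], a
    subfamily of about [min(|L|, q)] members is so sparse that each of them
    keeps half of its points to itself ([full_bound]).

    For [1 < m < D] the proof is a hairbrush argument, by induction on [D] and,
    for fixed [D], downwards on [m]. If the bound fails, a typical point of [P]
    lies on more than [q^((m-1)(D-m))] members of [L], and for a positive
    proportion of the members a positive proportion of their points is of this
    rich kind ([few_bad]). Fix such a member [A], and let [p] be one of its rich
    points. The members through [p] become subspaces of dimension [m - 1] modulo
    [p], and the bound for [(m-1, D-1)] says that [q^(D-1)] cosets of the line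
    of [p], none of them inside [A], carry a positive proportion of points of
    [P] ([shadow_large]). Each lies in a plane through [p], and over all rich
    [p] in [A] this yields [q^(m+D-3)] planes that are dense in [P] and meet [A]
    in a line ([many_planes]). Every such plane spans with [A] a subspace of
    dimension [m + 1], and those subspaces have no point outside [A] in common.
    Inside each of them the bound for [(2, m)] converts a number of planes into
    a number of points ([hair_planes_in_bound]). So either most planes lie in
    subspaces where that conversion is not saturated, and then [|P|] is already
    of order [q^(D+1)] ([poor_planes]); or at least [q^(D-m-1)] subspaces of
    dimension [m + 1] around [A] are themselves dense in [P] ([rich_planes]). In
    the latter case, varying [A] produces so many dense subspaces of dimension
    [m + 1] that the bound for [(m+1, D)] gives the claim ([step_bound]). *)

Set Implicit Arguments.
Unset Strict Implicit.
Unset Printing Implicit Defensive.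
Import Order.TTheory GRing.Theory Num.Theory.
Local Open Scope ring_scope.
Local Open Scope nat_scope.

(** * Counting incidences *)

Lemma card_filter_set (T : finType) (A : {set T}) (s : pred T) :
  #|[set x in A | s x]| = \sum_(x in A) s x.
Proof.
rewrite -sum1_card big_mkcond [RHS]big_mkcond /=.
by apply: eq_bigr => x _; rewrite inE; case: (x \in A); case: (s x).
Qed.

Lemma double_count (I J : finType) (r : I -> J -> bool)
    (A : {set I}) (B : {set J}) :
  \sum_(i in A) #|[set j in B | r i j]| = \sum_(j in B) #|[set i in A | r i j]|.
Proof.
under eq_bigr do rewrite card_filter_set.
by rewrite exchange_big; apply: eq_bigr => j _; rewrite card_filter_set.
Qed.

(** Most of the counting below has this shape: a lower bound for the number of
    incidences seen from one side against an upper bound seen from the other. *)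
Lemma incidence_bound (I J : finType) (r : I -> J -> bool)
    (A : {set I}) (B : {set J}) (K lo hi : nat) :
    (forall i, i \in A -> lo <= K * #|[set j in B | r i j]|) ->
    (forall j, j \in B -> #|[set i in A | r i j]| <= hi) ->
  #|A| * lo <= K * (hi * #|B|).
Proof.
move=> Hlo Hhi; rewrite -sum_nat_const.
apply: (@leq_trans (\sum_(i in A) K * #|[set j in B | r i j]|)); first exact: leq_sum.
rewrite -big_distrr leq_mul2l /= double_count mulnC -sum_nat_const.
by rewrite leq_sum ?orbT.
Qed.

Lemma subset_of_card (T : finType) (A : {set T}) s :
  s <= #|A| -> exists2 B : {set T}, B \subset A & #|B| = s.
Proof.
elim: s => [|s IHs] sA; first by exists set0; rewrite ?sub0set ?cards0.
have [B BA Bs] := IHs (ltnW sA).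
have /set0Pn[x] : A :\: B != set0.
  by rewrite -card_gt0 cardsD (setIidPr BA) Bs subn_gt0.
rewrite inE => /andP[xB xA]; exists (x |: B); last by rewrite cardsU1 xB Bs.
by rewrite subUset sub1set xA.
Qed.

(** * Finite spaces and projection from a point *)

Section VspaceFinite.
Import VectorInternalTheory.
Variables (F : finFieldType) (n : nat).
HB.instance Definition _ := [Countable of {vspace 'rV[F]_n} by <:].
HB.instance Definition _ := [Finite of {vspace 'rV[F]_n} by <:].
End VspaceFinite.

Section Subspaces.
Variables (F : finFieldType) (n : nat).
Local Notation V := 'rV[F]_n.
Local Notation q := #|F|.
Implicit Types (P : {set V}) (U W A B S : {vspace V}) (p x y : V).

Definition pts P W := [set x in P | x \in W].

Lemma card_field_gt1 : 1 < q.
Proof. exact: finNzRing_gt1. Qed.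

Lemma card_field_gt0 : 0 < q. Proof. exact: ltnW card_field_gt1. Qed.

Lemma card_vspaceE W : #|W| = q ^ \dim W.
Proof. exact: card_vspace. Qed.

Lemma card_vspace_set W : #|[set x in W]| = q ^ \dim W.
Proof. by rewrite cardsE card_vspaceE. Qed.

(** The quotient by the line through [p], realised inside the same space as
    the projection onto a complement, so that a single type of ambient space
    serves at all levels of the induction. *)
Definition quo p : 'End(V) := (\1%VF - projv <[p]>)%R.

Lemma quo_eq0 p x : (quo p x == 0%R) = (x \in <[p]>%VS).
Proof.
rewrite /quo add_lfunE opp_lfunE id_lfunE subr_eq0.
apply/eqP/idP => [-> | /projv_id->//]; exact: memv_proj.
Qed.

Lemma quo_eq p x y : (quo p x == quo p y) = (x - y \in <[p]>%VS)%R.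
Proof. by rewrite -quo_eq0 linearB subr_eq0. Qed.

Lemma mem_quo p W x : p \in W -> (quo p x \in (quo p @: W)%VS) = (x \in W).
Proof.
move=> pW; apply/idP/idP => [/memv_imgP[w wW /eqP]|]; last exact: memv_img.
rewrite quo_eq => xw; rewrite -(subrK w x) memvD //.
by apply: subvP xw; rewrite -memvE.
Qed.

Lemma quo_inj p W W' : p \in W -> p \in W' -> (quo p @: W = quo p @: W')%VS -> W = W'.
Proof.
by move=> pW pW' E; apply/vspaceP => x; rewrite -(mem_quo _ pW) E mem_quo.
Qed.

Lemma dim_quo p W : p != 0%R -> p \in W -> (\dim (quo p @: W)).+1 = \dim W.
Proof.
move=> p0 pW; rewrite -(limg_ker_dim (quo p) W).
suff -> : (W :&: lker (quo p) = <[p]>)%VS by rewrite dim_vline p0.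
apply/vspaceP => x; rewrite memv_cap memv_ker quo_eq0.
by rewrite andb_idl // => /vlineP[k ->]; rewrite memvZ.
Qed.

Lemma card_quo_fiber p y : #|[set x | quo p x == y]| <= q.
Proof.
have [->|[x0]] := set_0Vmem [set x | quo p x == y]; first by rewrite cards0.
rewrite inE -cardsT => /eqP <-.
apply: leq_trans (leq_imset_card (fun k : F => (x0 + k *: p)%R) [set: F]).
apply/subset_leq_card/subsetP => x; rewrite inE quo_eq => /vlineP[k Ek].
by apply/imsetP; exists k; rewrite // -Ek addrC subrK.
Qed.

(** The Gaussian binomial is at most [2^a q^(a(b-a))]. Count pairs of an
    [a]-dimensional subspace and a nonzero vector of it: the subspaces through
    a given vector are the [(a-1)]-dimensional subspaces of the quotient, while
    each subspace has at least half of [q^a] nonzero vectors. *)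
Lemma card_subspaces a U :
  #|[set W | (\dim W == a) && (W <= U)%VS]| <= 2 ^ a * q ^ (a * (\dim U - a)).
Proof.
elim: a U => [|a IHa] U.
  rewrite mul0n !expn0 muln1.
  apply: (@leq_trans #|[set (0%VS : {vspace V})]|); last by rewrite cards1.
  apply: subset_leq_card.
  by apply/subsetP => W; rewrite !inE dimv_eq0 => /andP[].
set X := [set W | _].
have [->|[W0]] := set_0Vmem X; first by rewrite cards0.
rewrite inE => /andP[/eqP dW0 W0U].
have aU : a < \dim U by rewrite -dW0 dimvS.
have lo W : W \in X ->
    q ^ a.+1 <= 2 * #|[set x in [set x in U | x != 0%R] | x \in W]|.
  rewrite inE => /andP[/eqP dW WU].
  have -> : [set x in [set x in U | x != 0%R] | x \in W] = [set x in W] :\ 0%R.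
    apply/setP => x; rewrite !inE.
    case: (boolP (x \in W)) => [xW|]; last by rewrite !andbF.
    by rewrite (subvP WU x xW) andbT.
  have := cardsD1 0%R [set x in W]; rewrite inE mem0v card_vspace_set dW.
  have := leq_trans card_field_gt1 (leq_pexp2l card_field_gt0 (ltn0Sn a)).
  by move: (_ ^ _) #|_ :\ _| => Q N; lia.
have hi x : x \in [set x in U | x != 0%R] ->
    #|[set W in X | x \in W]| <= 2 ^ a * q ^ (a * (\dim U - a.+1)).
  rewrite inE => /andP[xU x0].
  have := IHa (quo x @: U)%VS; have := dim_quo x0 xU.
  case: (\dim U) => [//|b] [->]; rewrite subSS; apply: leq_trans.
  rewrite -(card_in_imset (f := fun W => (quo x @: W)%VS)).
    apply/subset_leq_card/subsetP => _ /imsetP[W /[!inE] /andP[/andP[dW WU] xW] ->].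
    by rewrite limgS // andbT -eqSS dim_quo.
  by move=> W W'; rewrite !inE => /andP[_ xW] /andP[_ xW']; apply: quo_inj.
have := incidence_bound lo hi.
have : #|[set x in U | x != 0%R]| <= q ^ \dim U.
  by rewrite -card_vspaceE subset_leq_card //; apply/subsetP => x /[!inE] /andP[].
move: (#|[set x in U | _]|) => N hN hX.
have := leq_trans hX (leq_mul (leqnn 2) (leq_mul (leqnn _) hN)).
have -> : 2 * (2 ^ a * q ^ (a * (\dim U - a.+1)) * q ^ \dim U) =
   2 ^ a.+1 * q ^ (a.+1 * (\dim U - a.+1)) * q ^ a.+1.
  rewrite expnS -!mulnA -!expnD; congr (_ * (_ * _ ^ _)).
  by nia.
by rewrite leq_pmul2r // expn_gt0 card_field_gt0.
Qed.

End Subspaces.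

(** * The linear statement and its extreme cases *)

Definition cone (F : finFieldType) n (P : {set 'rV[F]_n}) :=
  (0%R \notin P) /\ (forall (t : F) x, t != 0%R -> x \in P -> (t *: x)%R \in P).

Definition dense_family (F : finFieldType) n m Lam (P : {set 'rV[F]_n})
    (L : {set {vspace 'rV[F]_n}}) :=
  forall W, W \in L -> \dim W = m /\ #|F| ^ m <= Lam * #|pts P W|.

(** With [Lam] and [C] playing the roles of inverse density and inverse
    constant, this says that [|P|] is at least
    [q^D min(|L| / q^(m(D-m)), q) / C]. *)
Definition union_bound_with m D Lam C :=
  forall (F : finFieldType) n (P : {set 'rV[F]_n}) (L : {set {vspace 'rV[F]_n}}),
    cone P -> dense_family m Lam P L ->
    #|F| ^ D * minn #|L| (#|F| ^ (m * (D - m)).+1)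
      <= C * #|F| ^ (m * (D - m)) * #|P|.

Definition union_bound m D := forall Lam, exists C, union_bound_with m D Lam C.

Lemma leq_card_bigcup (I T : finType) (A : {set I}) (G : I -> {set T}) :
  #|\bigcup_(i in A) G i| <= \sum_(i in A) #|G i|.
Proof.
elim/big_rec2: _ => [|i B N _ le]; first by rewrite cards0.
by apply: leq_trans (leq_card_setU _ _) _; rewrite leq_add2l.
Qed.

Section BaseCases.
Variables (F : finFieldType) (n : nat).
Local Notation V := 'rV[F]_n.
Local Notation q := #|F|.
Implicit Types (P : {set V}) (L : {set {vspace V}}).

(** When [q] is bounded, a single point in [P] is enough, because the minimum
    caps the left-hand side. *)
Lemma small_field_bound Q m D Lam P L :
    q <= Q -> dense_family m Lam P L ->
  q ^ D * minn #|L| (q ^ (m * (D - m)).+1)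
    <= Q ^ D.+1 * q ^ (m * (D - m)) * #|P|.
Proof.
move=> qQ dL; have [->|[W /dL[_ dW]]] := set_0Vmem L.
  by rewrite cards0 min0n muln0.
have P0 : 0 < #|P|.
  have : 0 < Lam * #|pts P W| by apply: leq_trans dW; rewrite expn_gt0 card_field_gt0.
  rewrite muln_gt0 => /andP[_ /leq_trans->//].
  by rewrite subset_leq_card //; apply/subsetP => x /[!inE] /andP[].
apply: leq_trans (leq_pmulr _ P0).
apply: leq_trans (leq_mul (leqnn _) (geq_minr _ _)) _.
by rewrite expnS mulnA -expnSr leq_mul2r leq_exp2r // qQ orbT.
Qed.

Lemma line_bound Lam P L : cone P -> dense_family 1 Lam P L ->
  #|L| * q <= Lam * #|P|.
Proof.
move=> [P0 _] dL; rewrite -[#|P|]mul1n.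
pose r (W : {vspace V}) x := x \in W.
apply: (incidence_bound (r := r)) => [W /dL[_]|x xP]; first by rewrite expn1.
rewrite /r.
apply/card_le1_eqP => W W'; rewrite !inE => /andP[/dL[dW _] xW] /andP[/dL[dW' _] xW'].
have x0 : x != 0%R by apply: contraNneq P0 => <-.
suff line U : \dim U = 1 -> x \in U -> (<[x]> == U)%VS.
  by rewrite -(eqP (line W dW xW)) (eqP (line W' dW' xW')).
by move=> dU xU; rewrite eqEdim -memvE xU dim_vline x0 dU.
Qed.

(** Take [s] members of the family with [s] of order [min(|L|, q) / (2 Lam)].
    Two members share at most [q^(D-1)] vectors, so the other [s - 1] members
    cover at most half of the points of any given one, and the remaining
    private points of different members are distinct. *)
Lemma full_bound D Lam P L : 0 < D -> dense_family D Lam P L ->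
  q ^ D * minn #|L| q <= 4 * Lam ^ 2 * #|P|.
Proof.
move=> D0 dL.
have [->|[W0 W0L]] := set_0Vmem L; first by rewrite cards0 min0n muln0.
have Lam0 : 0 < Lam.
  by case: Lam dL => [/(_ _ W0L)[_]|//]; rewrite mul0n leqn0 expn_eq0 -leqn0 leqNgt card_field_gt0.
set t := minn _ _; have t0 : 0 < t by rewrite leq_min card_field_gt0 (cardD1 W0) W0L.
(* Large enough for t <= 2 Lam s, small enough for s - 1 <= q / (2 Lam). *)
pose s := (t.-1 %/ (2 * Lam)).+1.
have ts : t <= 2 * Lam * s.
  have := ltn_ceil t.-1 (d := 2 * Lam); rewrite muln_gt0 Lam0 => /(_ isT).
  by rewrite prednK // mulnC.
have sq : 2 * Lam * s.-1 <= q.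
  rewrite /s /= mulnC; apply: leq_trans (leq_divM _ _) _.
  by apply: leq_trans (leq_pred _) (geq_minr _ _).
have st : s <= #|L|.
  apply: leq_trans (geq_minl _ q); rewrite -/t /s -ltnS -{2}(prednK t0) ltnS.
  by apply: leq_ltn_trans (leq_div _ _) _; rewrite ltnS.
have [L0 L0L sL0] := subset_of_card st.
pose priv (W : {vspace V}) x := (x \in W) && [forall W' in L0 :\ W, x \notin W'].
have lo W : W \in L0 -> q ^ D <= 2 * Lam * #|[set x in P | priv W x]|.
  move=> WL0; have [dW dPW] := dL W (subsetP L0L W WL0).
  have cov : pts P W \subset [set x in P | priv W x] :|:
      \bigcup_(W' in L0 :\ W) [set x in (W :&: W')%VS].
    apply/subsetP => x; rewrite !inE => /andP[-> xW]; rewrite /priv xW /=.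
    case: (boolP [forall W' in L0 :\ W, x \notin W']) => // /forall_inPn[W' W'L0].
    rewrite negbK => xW' /=; apply/bigcupP; exists W' => //.
    by rewrite inE memv_cap xW.
  have small : #|\bigcup_(W' in L0 :\ W) [set x in (W :&: W')%VS]| <= s.-1 * q ^ D.-1.
    have -> : s.-1 = #|L0 :\ W| by rewrite -sL0 (cardsD1 W L0) WL0.
    apply: leq_trans (leq_card_bigcup _ _) _.
    rewrite -sum_nat_const; apply: leq_sum => W'; rewrite !inE => /andP[W'W W'L0].
    have [dW' _] := dL W' (subsetP L0L W' W'L0).
    rewrite card_vspace_set leq_exp2l ?card_field_gt1 // -ltnS prednK // ltnNge -{1}dW'.
    apply: contra W'W => le.
    have W'S : (W' <= W)%VS.
      suff /eqP <- : (W :&: W' == W')%VS by exact: capvSl.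
      by rewrite eqEdim capvSr.
    by rewrite eqEdim W'S dW dW' /=.
  have := leq_trans (subset_leq_card cov) (leq_card_setU _ _).
  have := leq_mul sq (leqnn (q ^ D.-1)); rewrite -expnS prednK //.
  move: dPW small; move: (#|_|) (#|_|) (#|_|) (q ^ D) (q ^ D.-1) (s.-1) => a b c d e f.
  by nia.
have hi x : x \in P -> #|[set W in L0 | priv W x]| <= 1.
  move=> _; apply/card_le1_eqP => W W'; rewrite !inE.
  move=> /andP[WL0 /andP[xW priW]] /andP[W'L0 /andP[xW' _]]; apply/eqP.
  apply: contraTT xW' => W'W; have /forall_inP := priW; apply.
  by rewrite !inE W'L0 W'W.
have := incidence_bound lo hi; rewrite sL0 mul1n => H.
apply: leq_trans (leq_mul (leqnn _) ts) _.
have -> : q ^ D * (2 * Lam * s) = 2 * Lam * (s * q ^ D) by lia.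
apply: leq_trans (leq_mul (leqnn _) H) _.
by apply: eq_leq; rewrite mulnA; congr (_ * _); nia.
Qed.

End BaseCases.

Lemma union_bound1 D : 0 < D -> union_bound 1 D.
Proof.
case: D => // D _ Lam; exists Lam => F n P L cP dL.
have H := line_bound cP dL.
rewrite subn1 mul1n /= expnS.
apply: leq_trans (leq_mul (leqnn _) (geq_minl _ _)) _.
have -> : #|F| * #|F| ^ D * #|L| = #|F| ^ D * (#|L| * #|F|) by ring.
by apply: leq_trans (leq_mul (leqnn _) H) _; apply: eq_leq; ring.
Qed.

Lemma union_bound_full D : 0 < D -> union_bound D D.
Proof.
move=> D0 Lam; exists (4 * Lam ^ 2) => F n P L _ dL.
by rewrite subnn muln0 expn1 expn0 muln1; apply: full_bound dL.
Qed.

(** * Planes through a point of a fixed subspace *)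

Section Shadow.
Variables (F : finFieldType) (n : nat).
Local Notation V := 'rV[F]_n.
Local Notation q := #|F|.
Implicit Types (P : {set V}) (U W A B S : {vspace V}) (p x y : V).

Definition outside P A := [set x in P | x \notin A].

Lemma cone_outside P A : cone P -> cone (outside P A).
Proof.
move=> [P0 Pt]; split=> [|t x t0]; first by rewrite inE (negPf P0).
rewrite !inE => /andP[/(Pt _ _ t0)-> /=]; apply: contra => tA.
by rewrite -(scalerK t0 x) memvZ.
Qed.

(** The vectors [y] of the quotient by [p] outside the image of [A] whose
    fibre, a coset of the line of [p], has a proportion of at least
    [1 / (4 Lam)] of its vectors in [P]. Leaving out the image of [A] makes the
    planes found later meet [A] in a line only, and excludes [y = 0]. *)
Definition shadow Lam P A p :=
  [set y | (y \notin (quo p @: A)%VS)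
           && (q <= 4 * Lam * #|[set x in P | quo p x == y]|)].

Lemma shadow_cone Lam P A p : cone P -> cone (shadow Lam P A p).
Proof.
move=> [P0 Pt]; split=> [|t y t0]; first by rewrite inE mem0v.
rewrite !inE => /andP[yA yP]; apply/andP; split.
  by apply: contra yA => tA; rewrite -(scalerK t0 y) memvZ.
apply: leq_trans yP _; rewrite leq_mul2l; apply/orP; right.
rewrite -(card_imset _ (scalerI t0)); apply/subset_leq_card/subsetP => _ /imsetP[x + ->].
by rewrite !inE linearZ /= => /andP[/(Pt _ _ t0)-> /eqP->] /=.
Qed.

(** Another member meets [A] in at most [q^k] vectors, which for [2 Lam <= q]
    is at most half of the points that it has in [P]. *)
Lemma outside_dense Lam k P A W :
    2 * Lam <= q -> \dim A = k.+1 -> \dim W = k.+1 -> W != A ->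
    q ^ k.+1 <= Lam * #|pts P W| ->
  q ^ k.+1 <= 2 * Lam * #|pts (outside P A) W|.
Proof.
move=> qL dA dW WA dP.
have dWA : \dim (W :&: A) <= k.
  rewrite -ltnS ltn_neqAle -{2}dW dimvS ?capvSl // andbT.
  apply: contraNneq WA => dWA; rewrite eqEdim dA dW leqnn andbT.
  suff /eqP <- : (W :&: A == W)%VS by exact: capvSr.
  by rewrite eqEdim capvSl dW dWA /=.
have cov : pts P W \subset pts (outside P A) W :|: [set x in (W :&: A)%VS].
  apply/subsetP => x; rewrite !inE memv_cap => /andP[-> ->] /=.
  by rewrite andbT orNb.
have := leq_trans (subset_leq_card cov) (leq_card_setU _ _).
rewrite card_vspace_set => h.
have := leq_pexp2l (card_field_gt0 F) dWA.
have := leq_mul qL (leqnn (q ^ k)); rewrite -expnS.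
move: dP h; move: (#|_|) (#|_|) (q ^ k.+1) (q ^ _) (q ^ k) => a b c d e.
by nia.
Qed.

(** The points of [P] in [W] outside [A] are distributed over [q^k] fibres of
    size [q]. Fibres outside the shadow carry too few points to account for more
    than half of them, so a proportion of fibres is in the shadow. *)
Lemma shadow_dense Lam k P A W p :
    2 * Lam <= q -> \dim A = k.+1 -> \dim W = k.+1 -> W != A ->
    p != 0%R -> p \in A -> p \in W ->
    q ^ k.+1 <= Lam * #|pts P W| ->
  q ^ k <= 4 * Lam * #|pts (shadow Lam P A p) (quo p @: W)|.
Proof.
move=> qL dA dW WA p0 pA pW dP.
have dX := outside_dense qL dA dW WA dP.
set f := quo p in dX *.
set fW := [set y in (f @: W)%VS].
have cW : #|fW| = q ^ k.
  rewrite card_vspace_set; congr (_ ^ _); apply: succn_inj.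
  by rewrite (dim_quo p0 pW).
set X := pts _ _ in dX.
have cov : X \subset \bigcup_(y in fW) [set x in X | f x == y].
  apply/subsetP => x xX; apply/bigcupP; exists (f x); last by rewrite inE xX /=.
  by rewrite inE mem_quo //; move: xX; rewrite inE => /andP[].
have bound y : y \in fW ->
    4 * Lam * #|[set x in X | f x == y]| <= 4 * Lam * q * (y \in shadow Lam P A p) + q.
  rewrite inE => yW; case: (boolP (y \in shadow _ _ _ _)) => [_|].
    apply: (@leq_trans (4 * Lam * q)); last by rewrite muln1 leq_addr.
    rewrite leq_mul2l (leq_trans _ (card_quo_fiber p y)) ?orbT //.
    by apply/subset_leq_card/subsetP => x /[!inE] /andP[].
  rewrite muln0 add0n inE negb_and negbK -ltnNge => /orP[yA|/ltnW].
    rewrite (_ : [set _ in _ | _] = set0) ?cards0 ?muln0 //.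
    apply/setP => x; rewrite !inE; apply/negP => /andP[/andP[/andP[_ xA] _] /eqP fx].
    by move: yA; rewrite -fx mem_quo // (negPf xA).
  apply: leq_trans; rewrite leq_mul2l; apply/orP; right.
  apply/subset_leq_card/subsetP => x; rewrite !inE.
  by move=> /andP[/andP[/andP[-> _] _] ->].
have tot : 4 * Lam * #|X| <=
    4 * Lam * q * #|pts (shadow Lam P A p) (f @: W)%VS| + q ^ k.+1.
  apply: leq_trans (leq_mul (leqnn _) (subset_leq_card cov)) _.
  apply: leq_trans (leq_mul (leqnn _) (leq_card_bigcup _ _)) _.
  rewrite big_distrr /=.
  apply: (@leq_trans (\sum_(y in fW) (4 * Lam * q * (y \in shadow Lam P A p) + q))).
    exact: leq_sum.
  rewrite big_split /= sum_nat_const cW -expnSr leq_add2r -big_distrr leq_mul2l /=.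
  rewrite -card_filter_set; apply/orP; right.
  by apply/subset_leq_card/subsetP => x; rewrite !inE andbC.
rewrite -(leq_pmul2l (card_field_gt0 F)) -expnS.
move: dX tot; move: (#|X|) (#|pts _ _|) (q ^ _) => a b c.
by nia.
Qed.

(** The planes that play the part of the hairs in a hairbrush with handle [A]:
    they meet [A] in a line, and are dense in [P] away from [A]. *)
Definition hair_planes Lam P A := [set S : {vspace V} |
  [&& \dim S == 2, \dim (S :&: A) == 1 & q ^ 2 <= 8 * Lam * #|pts (outside P A) S|]].

(** Since [P] is a cone, all nonzero multiples of [y] have equally many points
    of [P] above them; this makes the whole plane dense and not only the coset
    of one vector. *)
Lemma shadow_plane Lam P A p y : cone P -> p != 0%R -> p \in A ->
  y \in shadow Lam P A p -> (quo p @^-1: <[y]>)%VS \in hair_planes Lam P A.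
Proof.
move=> cP p0 pA ySh; have := ySh; rewrite inE => /andP[yA yP].
set f := quo p in yA yP *; set S := (f @^-1: _)%VS.
have pS : p \in S.
  rewrite -memv_preim (_ : f p = 0%R) ?mem0v //.
  by apply/eqP; rewrite quo_eq0 memv_line.
have y0 : y != 0%R by apply: contraNneq yA => ->; rewrite mem0v.
have [x fx] : exists x, f x = y.
  have : 0 < 4 * Lam * #|[set x in P | f x == y]| by apply: leq_trans (card_field_gt0 F) yP.
  rewrite muln_gt0 => /andP[_ /card_gt0P[x]].
  by rewrite inE => /andP[_ /eqP fx]; exists x.
have fS : (f @: S = <[y]>)%VS.
  by rewrite lpreimK // -memvE -fx memv_img ?memvf.
have dS : \dim S = 2 by rewrite -(dim_quo p0 pS) -/f fS dim_vline y0.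
have SA : (S :&: A = <[p]>)%VS.
  apply/vspaceP => z; rewrite memv_cap -memv_preim; apply/andP/idP.
    move=> [/vlineP[t ft] zA]; rewrite -quo_eq0 -/f ft.
    have [->|t0] := eqVneq t 0%R; first by rewrite scale0r.
    case/negP: yA; rewrite -(scalerK t0 y) memvZ // -ft.
    by rewrite mem_quo.
  by move=> /vlineP[t ->]; rewrite linearZ /= !memvZ // memv_preim.
rewrite inE dS SA dim_vline p0 /=.
pose r t z := f z == (t *: y)%R.
have lo (t : F) : t \in [set~ 0%R] ->
    q <= 4 * Lam * #|[set z in pts (outside P A) S | r t z]|.
  rewrite !inE => t0; have [_ /(_ _ _ t0 ySh)] := shadow_cone Lam A p cP.
  rewrite inE => /andP[tyA] /leq_trans; apply; rewrite leq_mul2l; apply/orP; right.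
  apply/subset_leq_card/subsetP => z; rewrite !inE -/f /r => /andP[zP fz].
  rewrite zP fz -memv_preim (eqP fz) memvZ ?memv_line //= !andbT.
  by apply: contra tyA => zA; rewrite -(eqP fz) memv_img.
have hi z : z \in pts (outside P A) S -> #|[set t in [set~ 0%R] | r t z]| <= 1.
  move=> _; apply/card_le1_eqP => s t; rewrite !inE /r.
  move=> /andP[_ /eqP fs] /andP[_ /eqP ft].
  have : ((s - t) *: y == 0)%R by rewrite scalerBl -fs -ft subrr.
  by rewrite scaler_eq0 (negPf y0) orbF subr_eq0 => /eqP->.
have := incidence_bound lo hi; rewrite cardsC1 mul1n.
have := card_field_gt1 F; move: (#|pts _ _|) => a.
by case: q => // b; rewrite /= expnS expn1; nia.
Qed.

(** The vectors of the shadow that span the same plane with [p] lie on one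
    line of the quotient. *)
Lemma card_shadow Lam P A p : cone P -> p != 0%R -> p \in A ->
  #|shadow Lam P A p| <= q * #|[set S in hair_planes Lam P A | p \in S]|.
Proof.
move=> cP p0 pA.
have pS y : p \in (quo p @^-1: <[y]>)%VS.
  rewrite -memv_preim (_ : quo p p = 0%R) ?mem0v //.
  by apply/eqP; rewrite quo_eq0 memv_line.
pose r y (S : {vspace V}) := S == (quo p @^-1: <[y]>)%VS.
have lo y : y \in shadow Lam P A p ->
    1 <= 1 * #|[set S in [set S in hair_planes Lam P A | p \in S] | r y S]|.
  move=> ySh; rewrite mul1n card_gt0; apply/set0Pn; exists (quo p @^-1: <[y]>)%VS.
  by rewrite inE /r eqxx inE shadow_plane // pS.
have hi S : S \in [set S in hair_planes Lam P A | p \in S] ->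
    #|[set y in shadow Lam P A p | r y S]| <= q.
  rewrite !inE => /andP[/and3P[/eqP dS _ _] pSS].
  apply: (@leq_trans (q ^ \dim (quo p @: S))); last first.
    by rewrite -(leq_pmul2l (card_field_gt0 F)) -expnS (dim_quo p0 pSS) dS.
  rewrite -card_vspace_set; apply/subset_leq_card/subsetP => y.
  rewrite !inE => /andP[/andP[_ yP] /eqP ->].
  have [x fx] : exists x, quo p x = y.
    have : 0 < 4 * Lam * #|[set x in P | quo p x == y]| by apply: leq_trans (card_field_gt0 F) yP.
    rewrite muln_gt0 => /andP[_ /card_gt0P[x]].
    by rewrite inE => /andP[_ /eqP fx]; exists x.
  by rewrite lpreimK ?memv_line // -memvE -fx memv_img ?memvf.
by have := incidence_bound lo hi; rewrite muln1 mul1n.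
Qed.

End Shadow.

(** * The hairbrush of a subspace *)

(** The dimensions are [m = j + 2] and [D = j + e + 3], so that [1 < m < D]
    holds by construction and the exponents contain no subtraction:
    [D - m = e + 1] and [D - m - 1 = e]. *)
Section Hairbrush.
Variables (F : finFieldType) (n j e Lam C1 C2 : nat).
Local Notation V := 'rV[F]_n.
Local Notation q := #|F|.
Implicit Types (U W A B S T : {vspace V}) (p x y : V).
Variables (P : {set V}) (L : {set {vspace V}}).
Hypothesis B1 : union_bound_with j.+1 (j + e).+2 (4 * Lam) C1.
Hypothesis B2 : union_bound_with 2 j.+2 (8 * Lam) C2.
Hypothesis cP : cone P.
Hypothesis dL : dense_family j.+2 Lam P L.
Hypothesis qL : 2 * Lam <= q.

Definition through p := [set W in L | p \in W].
(** The threshold is the size [q^((m-1)(D-m))] at which the bound for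
    [(m-1, D-1)] in the quotient yields [q^(D-1)]; the inequality is strict in
    order to leave room for removing [A] from the members through [p]. *)
Definition rich_points := [set p in P | q ^ (j.+1 * e.+1) < #|through p|].

Lemma cone_neq0 p : p \in P -> p != 0%R.
Proof. by move=> pP; apply: contraNneq cP.1 => <-. Qed.

Lemma shadow_large A p : A \in L -> p \in A -> p \in rich_points ->
  q ^ (j + e).+2 <= C1 * #|shadow Lam P A p|.
Proof.
move=> AL pA; rewrite inE => /andP[/cone_neq0 p0 rich].
pose L' := [set (quo p @: W)%VS | W in through p :\ A].
have dL' : dense_family j.+1 (4 * Lam) (shadow Lam P A p) L'.
  move=> _ /imsetP[W + ->]; rewrite !inE => /and3P[WA WL pW].
  have [dW dPW] := dL WL; have [dA _] := dL AL.
  by split; [apply: succn_inj; rewrite (dim_quo p0 pW) | apply: shadow_dense].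
have cL' : q ^ (j.+1 * e.+1) <= #|L'|.
  rewrite card_in_imset; last first.
    move=> W W'; rewrite !inE => /and3P[_ _ pW] /and3P[_ _ pW']; exact: quo_inj.
  by move: rich; rewrite (cardsD1 A (through p)) inE AL pA ltnS.
have := B1 (shadow_cone Lam A p cP) dL'.
rewrite (_ : (j + e).+2 - j.+1 = e.+1); last by lia.
set N := q ^ (_ * _) in cL' *.
have N0 : 0 < N by rewrite expn_gt0 card_field_gt0.
have NN : N <= minn #|L'| (q ^ (j.+1 * e.+1).+1).
  by rewrite leq_min cL' leq_exp2l ?card_field_gt1 /=.
move=> /(leq_trans (leq_mul (leqnn _) NN)).
by rewrite mulnAC leq_pmul2r.
Qed.

(** Each rich point of [A] gives [q^(D-2)] planes, and a plane is counted by
    at most the [q] vectors of its line in [A]. *)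
Lemma many_planes A : A \in L -> q ^ j.+2 <= 2 * Lam * #|pts rich_points A| ->
  q ^ (2 * j + e + 2) <= 2 * Lam * C1 * #|hair_planes Lam P A|.
Proof.
move=> AL dG.
pose r p S := p \in S.
have lo p : p \in pts rich_points A ->
    q ^ (j + e).+1 <= C1 * #|[set S in hair_planes Lam P A | r p S]|.
  rewrite inE => /andP[pG pA].
  have p0 : p != 0%R by move: pG; rewrite inE => /andP[/cone_neq0].
  rewrite -(leq_pmul2l (card_field_gt0 F)) -expnS mulnCA.
  apply: leq_trans (shadow_large AL pA pG) _.
  by rewrite leq_mul2l card_shadow ?orbT.
have hi S : S \in hair_planes Lam P A -> #|[set p in pts rich_points A | r p S]| <= q.
  rewrite inE => /and3P[_ /eqP dSA _].
  apply: (@leq_trans (q ^ \dim (S :&: A))); last by rewrite dSA expn1.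
  rewrite -card_vspace_set; apply/subset_leq_card/subsetP => p.
  by rewrite !inE memv_cap /r => /andP[/andP[_ ->] ->].
have := incidence_bound lo hi.
have := leq_mul dG (leqnn (q ^ (j + e).+1)).
rewrite -expnD (_ : j.+2 + _ = (2 * j + e + 2).+1); last by lia.
rewrite expnS => h1 h2; rewrite -(leq_pmul2l (card_field_gt0 F)).
apply: leq_trans h1 _; rewrite -mulnA; apply: leq_trans (leq_mul (leqnn _) h2) _.
by apply: eq_leq; ring.
Qed.

Definition above A := [set T : {vspace V} | (\dim T == j.+3) && (A <= T)%VS].

Lemma span_above A S : A \in L -> S \in hair_planes Lam P A ->
  (A + S)%VS \in above A.
Proof.
move=> /dL[dA _]; rewrite !inE => /and3P[/eqP dS /eqP dSA _].
rewrite addvSl andbT.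
have := dimv_sum_cap A S; rewrite capvC dSA dA dS addn1 addn2 => -[->].
exact: eqxx.
Qed.

(** Two subspaces of dimension [m + 1] containing [A] have nothing outside [A]
    in common: [A] together with one more vector fills both. *)
Lemma above_unique A T T' U : A \in L -> T \in above A -> T' \in above A ->
  ~~ (U <= A)%VS -> (U <= T)%VS -> (U <= T')%VS -> T = T'.
Proof.
move=> /dL[dA _]; rewrite !inE => /andP[/eqP dT AT] /andP[/eqP dT' AT'] UA UT UT'.
have lt : j.+2 < \dim (A + U).
  rewrite ltn_neqAle -dA dimvS ?addvSl // andbT; apply: contra UA => /eqP dAU.
  suff /eqP -> : (A == A + U)%VS by exact: addvSr.
  by rewrite eqEdim addvSl -dAU /=.
have E X : \dim X = j.+3 -> (A <= X)%VS -> (U <= X)%VS -> (A + U)%VS = X.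
  by move=> dX AX UX; apply/eqP; rewrite eqEdim subv_add AX UX dX.
by rewrite -(E T) // -(E T').
Qed.

Definition hair_planes_in A T := [set S in hair_planes Lam P A | (S <= T)%VS].

(** Inside a subspace of dimension [m + 1] the planes are governed by the bound
    for [(2, m)], which is available because [m < D]. *)
Lemma hair_planes_in_bound A T :
  q ^ j.+2 * minn #|hair_planes_in A T| (q ^ (2 * j).+1)
    <= C2 * q ^ (2 * j) * #|pts (outside P A) T|.
Proof.
have cPT : cone (pts (outside P A) T).
  have [o0 oZ] := cone_outside A cP; split=> [|t x t0]; first by rewrite inE (negPf o0).
  by rewrite inE => /andP[/(oZ _ _ t0) xo xT]; rewrite inE xo memvZ.
have dS : dense_family 2 (8 * Lam) (pts (outside P A) T) (hair_planes_in A T).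
  move=> S; rewrite !inE => /andP[/and3P[/eqP-> _ SP] ST]; split => //.
  rewrite (_ : pts (pts _ T) S = pts (outside P A) S) //.
  apply/setP => x; rewrite !inE; case: (boolP (x \in S)) => [xS|]; last by rewrite !andbF.
  by rewrite (subvP ST x xS) !andbT.
by have := B2 cPT dS; rewrite subSS subSS subn0.
Qed.

(** The subspaces in which the bound for [(2, m)] saturates, and therefore
    yields a positive proportion of the whole subspace. *)
Definition rich_above A :=
  [set T in above A | q ^ (2 * j).+1 <= #|hair_planes_in A T|].

(** Without saturation the bound for [(2, m)] gives points in proportion to the
    number of planes. The points found in different subspaces are distinct, as
    they lie outside [A], so that the contributions add up. *)
Lemma poor_planes A : A \in L ->
  q ^ j.+2 * #|[set S in hair_planes Lam P A | (A + S)%VS \notin rich_above A]|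
    <= C2 * q ^ (2 * j) * #|P|.
Proof.
move=> AL; set N := [set S in _ | _].
pose Pi := above A :\: rich_above A.
pose r S T := (S <= T)%VS.
have cN : #|N| <= \sum_(T in Pi) #|[set S in N | r S T]|.
  rewrite -double_count -sum1_card; apply: leq_sum => S.
  rewrite inE => /andP[SP Sr]; rewrite card_gt0; apply/set0Pn.
  by exists (A + S)%VS; rewrite inE [r _ _]addvSr andbT in_setD Sr span_above.
have cT T : T \in Pi ->
    q ^ j.+2 * #|[set S in N | r S T]|
      <= C2 * q ^ (2 * j) * #|[set p in outside P A | p \in T]|.
  rewrite in_setD inE => /andP[poor aT]; rewrite aT /= -ltnNge in poor.
  apply: leq_trans (hair_planes_in_bound A T).
  rewrite leq_mul2l leq_min; apply/orP; right.
  have le : #|[set S in N | r S T]| <= #|hair_planes_in A T|.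
    by apply/subset_leq_card/subsetP => S; rewrite !inE /r => /andP[/andP[-> _] ->].
  by rewrite le (leq_trans le (ltnW poor)).
have cP' : \sum_(T in Pi) #|[set p in outside P A | p \in T]| <= #|P|.
  rewrite double_count; apply: (@leq_trans #|outside P A|); last first.
    by apply/subset_leq_card/subsetP => x /[!inE] /andP[].
  rewrite -sum1_card; apply: leq_sum => x; rewrite inE => /andP[_ xA].
  apply/card_le1_eqP => T T' /setIdP[/setDP[aT _] xT] /setIdP[/setDP[aT' _] xT'].
  by apply: (above_unique (U := <[x]>%VS) AL); rewrite -?memvE.
apply: leq_trans (leq_mul (leqnn _) cN) _.
apply: leq_trans (leq_mul (leqnn _) cP'); rewrite !big_distrr /=.
exact: leq_sum.
Qed.

Definition dense_above A :=
  [set T in above A | q ^ j.+3 <= C2 * #|pts P T|].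

(** A subspace of dimension [m + 1] contains at most [4 q^(2(m-1))] planes, so
    many planes in rich subspaces require many rich subspaces. *)
Lemma rich_planes A : A \in L ->
  #|[set S in hair_planes Lam P A | (A + S)%VS \in rich_above A]|
    <= 4 * q ^ (2 * j.+1) * #|dense_above A|.
Proof.
move=> AL; set N := [set S in _ | _].
pose r S T := (S <= T)%VS.
have lo S : S \in N -> 1 <= 1 * #|[set T in dense_above A | r S T]|.
  rewrite inE => /andP[SP]; rewrite inE => /andP[aT rich].
  rewrite mul1n card_gt0; apply/set0Pn; exists (A + S)%VS.
  rewrite inE [r _ _]addvSr inE aT /= andbT.
  have := hair_planes_in_bound A (A + S)%VS.
  rewrite (minn_idPr rich) -expnD (_ : j.+2 + _ = 2 * j + j.+3); last by lia.
  rewrite expnD -mulnA mulnCA leq_pmul2l ?expn_gt0 ?card_field_gt0 // => h.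
  apply: leq_trans h _; rewrite leq_mul2l; apply/orP; right.
  by apply/subset_leq_card/subsetP => x /[!inE] /andP[/andP[-> _] ->].
have hi T : T \in dense_above A -> #|[set S in N | r S T]| <= 4 * q ^ (2 * j.+1).
  rewrite !inE => /andP[/andP[/eqP dT _] _].
  have := card_subspaces 2 T; rewrite dT !subSS subn0; apply: leq_trans.
  by apply/subset_leq_card/subsetP => S; rewrite !inE /r => /andP[/andP[/andP[-> _] _] ->].
by have := incidence_bound lo hi; rewrite muln1 mul1n.
Qed.

Lemma hairbrush A : A \in L -> q ^ j.+2 <= 2 * Lam * #|pts rich_points A| ->
  q ^ (j + e + 4) <= 4 * Lam * C1 * C2 * #|P| \/
  q ^ e <= 16 * Lam * C1 * #|dense_above A|.
Proof.
move=> AL dG; have many := many_planes AL dG.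
set pl := hair_planes Lam P A in many.
pose rich S := (A + S)%VS \in rich_above A.
have split_pl : #|pl| <= #|[set S in pl | rich S]| + #|[set S in pl | ~~ rich S]|.
  apply: leq_trans (leq_card_setU _ _); apply/subset_leq_card/subsetP => S.
  by rewrite !inE => ->; case: (rich S).
have q0 := card_field_gt0 F.
have [le|le] := leqP #|pl| (2 * #|[set S in pl | ~~ rich S]|); [left|right].
  rewrite -(leq_pmul2l (_ : 0 < q ^ (2 * j))) ?expn_gt0 ?q0 //.
  rewrite -expnD (_ : _ + _ = j.+2 + (2 * j + e + 2)); last by lia.
  rewrite expnD; apply: leq_trans (leq_mul (leqnn _) many) _.
  apply: leq_trans (leq_mul (leqnn _) (leq_mul (leqnn _) le)) _.
  have -> X : q ^ j.+2 * (2 * Lam * C1 * (2 * X)) = 4 * Lam * C1 * (q ^ j.+2 * X) by ring.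
  apply: leq_trans (leq_mul (leqnn _) (poor_planes AL)) _.
  by apply: eq_leq; ring.
have le2 : #|pl| <= 2 * #|[set S in pl | rich S]| by lia.
rewrite -(leq_pmul2l (_ : 0 < q ^ (2 * j.+1))) ?expn_gt0 ?q0 //.
rewrite -expnD (_ : _ + _ = 2 * j + e + 2); last by lia.
apply: leq_trans many _.
apply: leq_trans (leq_mul (leqnn _) le2) _.
apply: leq_trans (leq_mul (leqnn _) (leq_mul (leqnn _) (rich_planes AL))) _.
by apply: eq_leq; ring.
Qed.

End Hairbrush.

(** * The induction *)

(** The three hypotheses [B1], [B2], [B3] are the bounds for [(m-1, D-1)],
    [(2, m)] and [(m+1, D)]; the last one is applied to subspaces of the
    density [1 / C2] that the second one produces. *)
Section Step.
Variables (F : finFieldType) (n j e Lam C1 C2 C3 : nat).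
Local Notation V := 'rV[F]_n.
Local Notation q := #|F|.
Implicit Types (U W A B S T : {vspace V}) (p x y : V).
Variables (P : {set V}) (L : {set {vspace V}}).
Hypothesis B1 : union_bound_with j.+1 (j + e).+2 (4 * Lam) C1.
Hypothesis B2 : union_bound_with 2 j.+2 (8 * Lam) C2.
Hypothesis B3 : union_bound_with j.+3 (j + e).+3 C2 C3.
Hypothesis cP : cone P.
Hypothesis dL : dense_family j.+2 Lam P L.
Hypothesis qL : 2 * Lam <= q.

Let rich := rich_points j e P L.
Let good := [set W in L | q ^ j.+2 <= 2 * Lam * #|pts rich W|].

(** A member outside [good] has at least half of its points at which few
    members meet, and such points account for few incidences in total. If these
    members are the majority of [L], then [P] is large enough already. *)
Lemma few_bad :
  #|L :\: good| * q ^ j.+2 <= 2 * Lam * (q ^ (j.+1 * e.+1) * #|P|).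
Proof.
pose r W p := p \in W.
have lo W : W \in L :\: good ->
    q ^ j.+2 <= 2 * Lam * #|[set p in P :\: rich | r W p]|.
  move=> /setDP[WL]; rewrite inE WL /= -ltnNge => lt; have [_ dW] := dL WL.
  have cov : pts P W \subset pts rich W :|: [set p in P :\: rich | r W p].
    apply/subsetP => x /setIdP[xP xW]; apply/setUP.
    by case: (boolP (x \in rich)) => xr; [left | right]; apply/setIdP; rewrite ?in_setD ?xr.
  have := leq_trans (subset_leq_card cov) (leq_card_setU _ _).
  move: dW lt; move: (q ^ _) (#|_|) (#|_|) (#|_|) => a b c d.
  by nia.
have hi p : p \in P :\: rich -> #|[set W in L :\: good | r W p]| <= q ^ (j.+1 * e.+1).
  move=> /setDP[pP]; rewrite inE pP /= -leqNgt; apply: leq_trans.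
  apply/subset_leq_card/subsetP => W /setIdP[/setDP[WL _] pW].
  by rewrite inE WL.
apply: leq_trans (incidence_bound lo hi) _.
by rewrite !leq_mul2l subset_leq_card ?orbT // subsetDl.
Qed.

(** Around each good member there are [q^(D-m-1)] dense subspaces of dimension
    [m + 1], and each of those contains at most [2^m q^m] subspaces of dimension
    [m]. *)
Lemma good_dense_planes :
    (forall A, A \in good -> q ^ e <= 16 * Lam * C1 * #|dense_above j C2 P A|) ->
  #|good| * q ^ e <= 16 * Lam * C1 * (2 ^ j.+2 * q ^ j.+2 *
    #|[set T : {vspace V} | (\dim T == j.+3) && (q ^ j.+3 <= C2 * #|pts P T|)]|).
Proof.
move=> H; set R := [set T | _].
pose r A T := (A <= T)%VS.
apply: (incidence_bound (r := r)) => [A AG|T].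
  apply: leq_trans (H A AG) _; rewrite leq_mul2l; apply/orP; right.
  apply/subset_leq_card/subsetP => T; rewrite /r !inE.
  by move=> /andP[/andP[-> ->] ->].
rewrite inE => /andP[/eqP dT _].
have := card_subspaces j.+2 T; rewrite dT subSnn muln1; apply: leq_trans.
apply/subset_leq_card/subsetP => A /setIdP[/setIdP[/dL[dA _] _] AT].
by rewrite inE dA eqxx.
Qed.

Lemma step_bound :
  q ^ (j + e).+3 * minn #|L| (q ^ (j.+2 * e.+1).+1)
  <= (4 * Lam + 4 * Lam * C1 * C2 + C3 + 32 * Lam * C1 * 2 ^ j.+2 * C3)
     * q ^ (j.+2 * e.+1) * #|P|.
Proof.
have q0 := card_field_gt0 F.
have weaken K C X : X <= K * q ^ (j.+2 * e.+1) * #|P| -> K <= C ->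
    X <= C * q ^ (j.+2 * e.+1) * #|P|.
  by move=> h1 h2; apply: leq_trans h1 _; rewrite !leq_mul2r h2 !orbT.
have saturated K : q ^ (j + e).+4 <= K * #|P| ->
    q ^ (j + e).+3 * minn #|L| (q ^ (j.+2 * e.+1).+1)
    <= K * q ^ (j.+2 * e.+1) * #|P|.
  move=> h; apply: leq_trans (leq_mul (leqnn _) (geq_minr _ _)) _.
  by rewrite (expnS _ (_ * _)) mulnA -expnSr mulnAC leq_pmul2r ?expn_gt0 ?q0.
have sL : #|L| <= #|L :\: good| + #|good|.
  by rewrite -[#|L|](cardsID good) addnC leq_add2l subset_leq_card // subsetIr.
have [le|lt] := leqP #|L| (2 * #|L :\: good|).
  apply: (weaken (4 * Lam)); last by lia.
  apply: leq_trans (leq_mul (leqnn _) (geq_minl _ _)) _.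
  apply: leq_trans (leq_mul (leqnn _) le) _.
  rewrite (_ : (j + e).+3 = e.+1 + j.+2) ?expnD; last by lia.
  have -> X : q ^ e.+1 * q ^ j.+2 * (2 * X) = 2 * q ^ e.+1 * (X * q ^ j.+2) by ring.
  apply: leq_trans (leq_mul (leqnn _) few_bad) _.
  rewrite [j.+2 * _]mulSn expnD; apply: eq_leq; ring.
have [le|nle] := leqP (q ^ (j + e + 4)) (4 * Lam * C1 * C2 * #|P|).
  by apply: weaken (saturated _ _) _; [rewrite -addn4; exact: le | lia].
have dense A : A \in good -> q ^ e <= 16 * Lam * C1 * #|dense_above j C2 P A|.
  move=> /setIdP[AL dA].
  by case: (hairbrush B1 B2 cP dL qL AL dA) => //; rewrite leqNgt nle.
have := good_dense_planes dense; set R := [set T | _] => HR.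
have dR : dense_family j.+3 C2 P R by move=> T; rewrite inE => /andP[/eqP].
have := B3 cP dR; rewrite !subSS (_ : j + e - j = e) ?addKn //.
rewrite /minn; case: ifP => _ h; last first.
  apply: (weaken C3); last by lia.
  apply: saturated; rewrite -(leq_pmul2r (_ : 0 < q ^ (j.+3 * e))) ?expn_gt0 ?q0 //.
  by move: h; rewrite (expnS _ (_ * _)) mulnA -expnSr mulnAC.
apply: (weaken (32 * Lam * C1 * 2 ^ j.+2 * C3)); last by lia.
apply: leq_trans (leq_mul (leqnn _) (geq_minl _ _)) _.
rewrite -(leq_pmul2r (_ : 0 < q ^ e)) ?expn_gt0 ?q0 //.
have le : #|L| <= 2 * #|good| by lia.
apply: leq_trans (leq_mul (leq_mul (leqnn _) le) (leqnn _)) _.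
have -> X : q ^ (j + e).+3 * (2 * X) * q ^ e = 2 * q ^ (j + e).+3 * (X * q ^ e) by ring.
apply: leq_trans (leq_mul (leqnn _) HR) _.
have -> : 2 * q ^ (j + e).+3 * (16 * Lam * C1 * (2 ^ j.+2 * q ^ j.+2 * #|R|)) =
   32 * Lam * C1 * 2 ^ j.+2 * q ^ j.+2 * (q ^ (j + e).+3 * #|R|) by ring.
apply: leq_trans (leq_mul (leqnn _) h) _.
have -> : 32 * Lam * C1 * 2 ^ j.+2 * C3 * q ^ (j.+2 * e.+1) * #|P| * q ^ e =
  32 * Lam * C1 * 2 ^ j.+2 * C3 * #|P| * (q ^ (j.+2 * e.+1) * q ^ e) by ring.
rewrite -expnD (_ : _ + e = j.+2 + j.+3 * e) ?expnD; last by lia.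
by apply: eq_leq; ring.
Qed.

End Step.

Lemma union_bound_step j e :
    union_bound j.+1 (j + e).+2 -> union_bound 2 j.+2 ->
    union_bound j.+3 (j + e).+3 ->
  union_bound j.+2 (j + e).+3.
Proof.
move=> U1 U2 U3 Lam.
have [C1 B1] := U1 (4 * Lam); have [C2 B2] := U2 (8 * Lam); have [C3 B3] := U3 C2.
set K := 4 * Lam + 4 * Lam * C1 * C2 + C3 + 32 * Lam * C1 * 2 ^ j.+2 * C3.
exists ((2 * Lam) ^ (j + e).+4 + K) => F n P L cP dL.
(* Fields with q <= 2 Lam account for the first summand of the constant. *)
have [qL|/ltnW qL] := leqP #|F| (2 * Lam).
  apply: leq_trans (small_field_bound _ qL dL) _.
  by rewrite !leq_mul2r leq_addr !orbT.
rewrite (_ : (j + e).+3 - j.+2 = e.+1); last by lia.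
apply: leq_trans (step_bound B1 B2 B3 cP dL qL) _.
by rewrite !leq_mul2r leq_addl !orbT.
Qed.

(** Of the three bounds that the step relies on, two have a smaller [D]; the
    third has the same [D] but a smaller [D - m]. *)
Lemma linear_union_bound m D : 0 < m <= D -> union_bound m D.
Proof.
move: m; elim/ltn_ind: D => D IHD m /andP[m0 mD].
have [r Er] : exists r, r = D - m by exists (D - m).
elim: r m m0 mD Er => [|e IHe] m m0 mD Er.
  by rewrite (_ : m = D); [apply: union_bound_full; lia | lia].
case: m m0 mD Er => // -[|j] _ mD Er; first by apply: union_bound1; lia.
have DE : D = (j + e).+3 by lia.
rewrite DE; apply: union_bound_step.
- by apply: IHD; lia.
- by apply: IHD; lia.
- by rewrite -DE; apply: IHe; lia.
Qed.

(** * From affine planes to linear subspaces *)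

Section Homogenize.
Variables (F : finFieldType) (n : nat).
Local Notation V := 'rV[F]_n.
Local Notation V' := 'rV[F]_(1 + n).
Local Notation q := #|F|.

(** The embedding of affine space as the hyperplane of height 1. *)
Definition lift1 (x : V) : V' := row_mx 1%:M x.

Lemma lift1_scale_inj (s t : F) x y :
  (s *: lift1 x = t *: lift1 y -> s = t /\ s *: x = t *: y)%R.
Proof.
rewrite /lift1 !scale_row_mx => /eq_row_mx[/matrixP/(_ 0 0)%R].
by rewrite !mxE eqxx !mulr1.
Qed.

(** The translate of [W] by [v] is the slice at height 1 of the span of [v]
    at height 1 and [W] at height 0. *)
Lemma kplane_lift k (X : {set V}) : kplane k X ->
  exists2 U : {vspace V'}, \dim U = k.+1 & forall x, (lift1 x \in U) = (x \in X).
Proof.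
move=> [v [W [dW ->]]].
pose g : 'Hom(V, V') := linfun (mulmxr (row_mx 0%R 1%:M)).
have gE x : g x = row_mx 0%R x by rewrite lfunE /= mul_mx_row mulmx0 mulmx1.
have g0 : (W :&: lker g = 0)%VS.
  apply/eqP; rewrite -subv0; apply/subvP => x; rewrite memv_cap memv_ker gE => /andP[_].
  by rewrite -row_mx0 => /eqP/eq_row_mx[_ ->]; rewrite mem0v.
have disj : (<[lift1 v]> :&: g @: W = 0)%VS.
  apply/eqP; rewrite -subv0; apply/subvP => x; rewrite memv_cap.
  move=> /andP[/vlineP[t ->] /memv_imgP[w _]].
  rewrite gE /lift1 scale_row_mx => /eq_row_mx[/matrixP/(_ 0 0)%R + _].
  rewrite !mxE mulr1 => ->.
  by rewrite -scale_row_mx scale0r mem0v.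
exists (<[lift1 v]> + g @: W)%VS => [|x].
  rewrite dimv_disjoint_sum // limg_dim_eq // dW dim_vline.
  suff -> : lift1 v != 0%R by [].
  rewrite -row_mx0; apply/eqP => /eq_row_mx[/matrixP/(_ 0 0)%R].
  by rewrite !mxE => /eqP; rewrite oner_eq0.
apply/memv_addP/imsetP => [[_ /vlineP[t ->] [_ /memv_imgP[w wW ->]]]|[w wW ->]].
  rewrite gE /lift1 scale_row_mx add_row_mx => /eq_row_mx[/matrixP/(_ 0 0)%R + ->].
  by rewrite !mxE mulr1 addr0 => <-; exists w; rewrite ?scale1r.
exists (lift1 v); first exact: memv_line.
exists (g w); first exact: memv_img.
by rewrite gE /lift1 add_row_mx addr0.
Qed.

Lemma card_kplane k (X : {set V}) : kplane k X -> #|X| = q ^ k.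
Proof.
move=> [v [W [<- ->]]]; rewrite card_imset; last by move=> x y /addrI.
by rewrite -card_vspace_set; apply: eq_card => x; rewrite inE.
Qed.

(** The punctured cone over a set of points placed at height 1. *)
Definition cone_over (X : {set V}) : {set V'} :=
  [set z.1 *: lift1 z.2 | z in setX [set~ 0] X]%R.

Lemma lift1_scale_injective (X : {set V}) :
  {in setX [set~ 0%R] X &, injective (fun z : F * V => z.1 *: lift1 z.2)%R}.
Proof.
move=> [s x] [t y]; rewrite !inE /= => /andP[s0 _] _ /lift1_scale_inj[<-].
by move=> /(scalerI s0) ->.
Qed.

Lemma cone_over_cone X : cone (cone_over X).
Proof.
split=> [|t _ t0 /imsetP[[s x] + ->]].
  apply/negP => /imsetP[[s x] /= + E]; rewrite !inE /=.
  move: E; rewrite -(scale0r (lift1 0)) => /lift1_scale_inj[<- _].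
  by rewrite eqxx.
rewrite !inE /= => /andP[s0 xX]; rewrite scalerA; apply/imsetP.
by exists ((t * s)%R, x); rewrite // !inE /= mulf_neq0.
Qed.

Lemma card_cone_over X : #|cone_over X| = q.-1 * #|X|.
Proof. by rewrite card_in_imset ?cardsX ?cardsC1 //; exact: lift1_scale_injective. Qed.

(** Passing to cones multiplies the union by [q - 1] and replaces [q^k] by
    [(q - 1) q^k], at least half of [q^(k+1)]; whence the density [1 / 2]. *)
Lemma union_of_kplanes k d C (L : {set {set V}}) :
    union_bound_with k.+1 d.+1 2 C -> (forall X, X \in L -> kplane k X) ->
  q ^ d * minn #|L| (q ^ (k.+1 * (d - k)).+1)
    <= C * q ^ (k.+1 * (d - k)) * #|\bigcup_(X in L) X|.
Proof.
move=> UB kL; set Y := \bigcup_(X in L) X.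
pose slice (U : {vspace V'}) := [set x | lift1 x \in U].
pose L' := [set U : {vspace V'} | (\dim U == k.+1) && (slice U \in L)].
(* Each plane of L is the slice of some member of L'. *)
have cL : #|L| <= #|L'|.
  apply: leq_trans (leq_imset_card slice L').
  apply/subset_leq_card/subsetP => X XL.
  have [U dU UX] := kplane_lift (kL X XL).
  have EX : X = slice U by apply/setP => x; rewrite inE UX.
  by apply/imsetP; exists U; rewrite // inE dU eqxx -EX XL.
have q1 := card_field_gt1 F.
have dL' : dense_family k.+1 2 (cone_over Y) L'.
  move=> U; rewrite inE => /andP[/eqP dU UL]; split => //.
  have : #|cone_over (slice U)| <= #|pts (cone_over Y) U|.
    apply/subset_leq_card/subsetP => _ /imsetP[[t x] + ->].
    rewrite !inE /= => /andP[t0 xU]; rewrite memvZ // andbT.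
    apply/imsetP; exists (t, x) => //; rewrite !inE /= t0.
    by apply/bigcupP; exists (slice U); rewrite ?inE.
  rewrite card_cone_over (card_kplane (kL _ UL)) expnS.
  move: (#|pts _ _|) (q ^ k) => a b; case: q q1 => // c /= c1 h.
  by nia.
have := UB F (1 + n) _ _ (cone_over_cone Y) dL'; rewrite subSS card_cone_over.
move=> h; rewrite -(leq_pmul2l (ltnW q1)) mulnA -expnS.
apply: (@leq_trans (q ^ d.+1 * minn #|L'| (q ^ (k.+1 * (d - k)).+1))).
  by rewrite leq_mul2l leq_min !geq_min cL leqnn !orbT.
apply: leq_trans h _.
by rewrite [q * _]mulnCA leq_mul2l leq_mul2r leq_pred !orbT.
Qed.

End Homogenize.

Local Open Scope ring_scope.

Theorem theorem1p6 (R : realType) (d k : nat) (hk : (0 < k)%N) (hkd : (k <= d)%N) :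
  exists c : R, 0 < c /\
    forall (F : finFieldType) (n : nat) (beta : R) (L : {set {set 'rV[F]_n}}),
      (0 < n)%N -> 0 <= beta -> beta <= 1 ->
      (forall P, P \in L -> kplane k P) ->
      #|F|%:R `^ ((k.+1 * (d - k))%:R + beta) <= #|L|%:R ->
      c * #|F|%:R `^ (d%:R + beta) <= #|\bigcup_(P in L) P|%:R.
Proof.
have /(_ 2)[C UB] : union_bound k.+1 d.+1 by apply: linear_union_bound; rewrite ltnS.
exists (C.+1%:R)^-1; split=> [|F n b L _ b0 b1 kL cL]; first by rewrite invr_gt0 ltr0n.
have := union_of_kplanes UB kL.
move: cL; set e := (k.+1 * (d - k))%N; set Y := \bigcup_(P in L) P.
set q := #|F|; have q1 : (1 < q)%N := card_field_gt1 F; have q0 : (0 < q)%N := ltnW q1.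
have qR : (0 : R) < q%:R by rewrite ltr0n.
set M := q%:R `^ b.
have powE m : q%:R `^ (m%:R + b) = (q ^ m)%:R * M :> R.
  by rewrite powRD ?powR_mulrn ?natrX ?ler0n // (gt_eqF qR) implybT.
rewrite !powE => cL.
have Mq : M <= q%:R by rewrite -[leRHS]powRr1 ?ler0n // ler_powR // ler1n.
rewrite -(ler_nat R) !natrM => h.
(* This is where beta <= 1 enters: q ^ beta does not exceed the cap q. *)
have lo : (q ^ e)%:R * M <= (minn #|L| (q ^ e.+1))%:R :> R.
  rewrite /minn; case: ifP => _ //.
  by rewrite expnSr natrM ler_wpM2l ?ler0n.
have qe0 : (0 : R) < (q ^ e)%:R by rewrite ltr0n expn_gt0 q0.
have hh := le_trans (ler_wpM2l (ler0n _ _) lo) h.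
have : (q ^ d)%:R * M <= C%:R * #|Y|%:R.
  by rewrite -(ler_pM2l qe0) mulrCA (le_trans hh) // mulrCA mulrA.
rewrite ler_pdivrMl ?ltr0n // => hY.
by apply: le_trans hY _; rewrite ler_wpM2r ?ler0n // ler_nat.
Qed.
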